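(* Let $(\mathcal{M},\theta)$ be a compact metric space with a Borel probability measure $\mu$, and suppose that $(\mathcal{M},\theta,\mu)$ is $d$-rectifiable, with associated map $f:\mathcal{O}\to\mathcal{M}$ having Lipschitz constant $\mathrm{Lip}(f)$. Then for each integer $N\ge1$ there exists an equal-measure partition $\mathcal{R}_N$ of $\mathcal{M}$ such that $$\mathrm{Diam}_1(\mathcal{R}_N,\theta)\le d\,2^{d-1}\,\mathrm{Lip}(f)\,N^{-1/d}.$$
   Context: $d$-rectifiable: a compact metric space $(\mathcal{M},\theta)$ with Borel probability measure $\mu$ is $d$-rectifiable if there exist a finite non-negative measure $\nu$ on the unit cube $I^d=[0,1]^d$, absolutely continuous with respect to $d$-dimensional Lebesgue measure, a measurable subset $\mathcal{O}\subset I^d$, and an injective Lipschitz map $f:\mathcal{O}\to\mathcal{M}$ (with respect to the Euclidean metric $\|\cdot\|$ on $\mathcal{O}$ and $\theta$ on $\mathcal{M}$) such that $\mu(\mathcal{M}\setminus f(\mathcal{O}))=0$ and $\mu(\mathcal{E})=\nu(f^{-1}(\mathcal{E}\cap f(\mathcal{O})))$ for every $\mu$-measurable $\mathcal{E}\subset\mathcal{M}$. $\mathrm{Lip}(f)$ is the smallest $c$ with $\theta(f(Z_1),f(Z_2))\le c\|Z_1-Z_2\|$ for all $Z_1,Z_2\in\mathcal{O}$. Equal-measure partition: a collection $\mathcal{R}_N=\{V_i\}_{i=1}^N$ of $\mu$-measurable subsets of $\mathcal{M}$ with $\mu(\mathcal{M}\setminus\bigcup_iV_i)=0$, $\mu(V_i\cap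 V_j)=0$ for $i\ne j$, and $\mu(V_i)=N^{-1}$ for all $i$. Average diameter: $\mathrm{Diam}_1(\mathcal{R}_N,\theta)=\frac1N\sum_{i=1}^N\mathrm{diam}(V_i,\theta)$, where $\mathrm{diam}(V,\theta)=\sup\{\theta(y_1,y_2):y_1,y_2\in V\}$. *)

(* Defs.v *)
From HB Require Import structures.
From mathcomp Require Import all_boot all_order all_algebra.
From mathcomp Require Import all_classical all_reals all_analysis.
From mathcomp Require Import measurable_realfun.
Import Order.TTheory GRing.Theory Num.Theory.
Import numFieldNormedType.Exports.

Set Implicit Arguments.
Unset Strict Implicit.
Unset Printing Implicit Defensive.

Local Open Scope classical_set_scope.
Local Open Scope ring_scope.

(* Measurable types are pointed in MathComp-Analysis, metric spaces are not.
   The point is no restriction here: a space carrying a probability measure is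
   nonempty. *)
#[short(type="pointedMetricType")]
HB.structure Definition PointedMetric (K : numDomainType) :=
  { M of Pointed M & Metric K M }.

Notation borel M := (g_sigma_algebraType (@open M)).

Section completion.
Context d (T : measurableType d) (R : realType).
Variable mu : {measure set T -> \bar R}.

(* A measure of the library is only meaningful on the sigma-algebra of T.  The
   two definitions below give its completion: E is mu-measurable when it is the
   union of a measurable set and of a subset of a mu-null set, and the completed
   measure is the restriction to these sets of the outer measure induced by mu
   (which coincides with mu on the sigma-algebra of T). *)
Definition mu_measurable : set (set T) := completed_algebra_gen mu.

Definition completed : set T -> \bar R := (mu^*)%mu.

End completion.

Section lebesgue_tuple.
Context {R : realType}.
Local Notation rT := (measurableTypeR R).
Local Open Scope ereal_scope.

Definition cons_pair n (p : rT * n.-tuple rT) : n.+1.-tuple rT :=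
  [tuple of p.1 :: p.2].

Lemma measurable_cons_pair n : measurable_fun [set: rT * n.-tuple rT]
  (@cons_pair n).
Proof. exact: measurable_cons. Qed.

Section step.
Variables (n : nat) (m : {sigma_finite_measure set (n.-tuple rT) -> \bar R}).

Definition lebesgue_cons : set (n.+1.-tuple rT) -> \bar R :=
  pushforward (@lebesgue_measure R \x m) (@cons_pair n).

Let lebesgue_cons0 : lebesgue_cons set0 = 0.
Proof. by rewrite /lebesgue_cons /pushforward preimage_set0 measure0. Qed.

Let lebesgue_cons_ge0 A : 0 <= lebesgue_cons A.
Proof. by rewrite /lebesgue_cons /pushforward; exact: measure_ge0. Qed.

Let lebesgue_cons_sigma_additive : semi_sigma_additive lebesgue_cons.
Proof.
move=> F mF tF mUF; rewrite /lebesgue_cons /pushforward preimage_bigcup.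
have mcF A : measurable A -> measurable (@cons_pair n @^-1` A).
  by move=> mA; rewrite -[X in measurable X]setTI; exact: measurable_cons_pair.
apply: measure_semi_sigma_additive => [k||]; first exact: mcF.
- apply/trivIsetP => /= i j _ _ ij; rewrite -preimage_setI.
  by move/trivIsetP : tF => /(_ _ _ _ _ ij) ->//; rewrite preimage_set0.
- by rewrite -preimage_bigcup; exact: mcF.
Qed.

HB.instance Definition _ := isMeasure.Build _ _ _ lebesgue_cons
  lebesgue_cons0 lebesgue_cons_ge0 lebesgue_cons_sigma_additive.

Let lebesgue_cons_sigma_finite : sigma_finite [set: n.+1.-tuple rT] lebesgue_cons.
Proof.
have /sigma_finiteP[F [TF ndF Foo]] := sigma_finiteT (@lebesgue_measure R).
have /sigma_finiteP[G [TG ndG Goo]] := sigma_finiteT m.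
pose U (t : n.+1.-tuple rT) : rT := thead t.
pose W (t : n.+1.-tuple rT) : n.-tuple rT := [tuple of behead t].
exists (fun k => U @^-1` F k `&` W @^-1` G k).
  rewrite predeqE => t; split=> // _.
  have [i _ Fi] : (\bigcup_k F k) (U t) by rewrite -TF.
  have [j _ Gj] : (\bigcup_k G k) (W t) by rewrite -TG.
  exists (maxn i j) => //; split.
  - by have /subsetPset := ndF _ _ (leq_maxl i j); apply.
  - by have /subsetPset := ndG _ _ (leq_maxr i j); apply.
move=> k; have [mF Fk] := Foo k; have [mG Gk] := Goo k; split.
  apply: measurableI; rewrite -[X in measurable X]setTI.
  - exact: (measurable_tnth ord0).
  - exact: measurable_behead.
rewrite /lebesgue_cons /pushforward.
rewrite (_ : _ @^-1` _ = F k `*` G k); last first.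
  apply/seteqP; split => -[x y] /= [h1 h2]; split => //=.
  - by move: h2; congr (G k _); exact/val_inj.
  - by move: h2; congr (G k _); exact/val_inj.
by rewrite product_measure1E// lte_mul_pinfty// ge0_fin_numE.
Qed.

HB.instance Definition _ := Measure_isSigmaFinite.Build _ _ _ lebesgue_cons
  lebesgue_cons_sigma_finite.

End step.

(* Lebesgue measure on R^n, as the n-fold product of the one-dimensional one
   (the Dirac mass at the only point for n = 0). *)
Fixpoint lebesgue_tuple n : {sigma_finite_measure set (n.-tuple rT) -> \bar R} :=
  match n with
  | 0 => @dirac _ (0.-tuple rT) [tuple] R
  | k.+1 => lebesgue_cons (lebesgue_tuple k)
  end.

Lemma lebesgue_tuple_box n (A : 'I_n -> set rT) :
  (forall i, measurable (A i)) ->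
  lebesgue_tuple n [set x | forall i, A i (tnth x i)] =
  \prod_(i < n) lebesgue_measure (A i).
Proof.
elim: n A => [|n ih] A mA.
  by rewrite big_ord0 /= diracE mem_set// => -[].
rewrite big_ord_recl -ih// /= /lebesgue_cons /pushforward.
rewrite (_ : _ @^-1` _ = A ord0 `*`
    [set x | forall i : 'I_n, A (lift ord0 i) (tnth x i)]); last first.
  apply/seteqP; split => -[x y] /= h.
  - split=> [|i]; first exact: (h ord0).
    by have := h (lift ord0 i); rewrite tnthS.
  - case: h => /= h0 hS i; have [j ->|->//] := unliftP ord0 i.
    by rewrite tnthS.
rewrite product_measure1E//.
rewrite (_ : [set x | _] = \big[setI/setT]_(i < n)
    (@tnth _ rT ^~ i @^-1` A (lift ord0 i))).
  apply: bigsetI_measurable => i _; rewrite -[X in measurable X]setTI.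
  exact: measurable_tnth.
by rewrite -bigcap_seq; apply/seteqP; split => x /= h i => [_|];
  [exact: h | apply: h; rewrite /= mem_index_enum].
Qed.

End lebesgue_tuple.

Notation Rtuple R d := (d.-tuple (measurableTypeR R)).

Section rectifiable.
Context {R : realType} {d : nat} {M : pointedMetricType R}.
Implicit Types (mu : probability (borel M) R) (O : set (Rtuple R d))
  (f : Rtuple R d -> M).

Definition unit_cube : set (Rtuple R d) :=
  [set x | forall i, 0 <= (tnth x i : R) <= 1].

Definition euclidean_dist (x y : Rtuple R d) : R :=
  Num.sqrt (\sum_(i < d) ((tnth x i : R) - tnth y i) ^+ 2).

(* A map O -> M is encoded as a total function of which only the values on O
   are used. *)
Definition lipschitz_constants O f : set R :=
  [set c | forall x y, O x -> O y -> mdist (f x) (f y) <= c * euclidean_dist x y].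

Definition Lip O f : R := inf (lipschitz_constants O f).

(* A measure on the unit cube is a measure on R^d for which the complement of
   the cube is null; since nu is absolutely continuous, its completion is defined
   on all Lebesgue measurable sets. *)
Definition rectifiable_by mu O f : Prop :=
  exists nu : {finite_measure set (Rtuple R d) -> \bar R},
    [/\ nu (~` unit_cube) = 0%E,
        nu `<< lebesgue_tuple d,
        mu_measurable (lebesgue_tuple d) O /\ O `<=` unit_cube,
        {in O &, injective f} /\ lipschitz_constants O f !=set0 &
        completed mu (~` (f @` O)) = 0%E /\
        forall E, mu_measurable mu E ->
          completed mu E = completed nu (O `&` f @^-1` (E `&` f @` O))].

Definition rectifiable mu : Prop := exists O f, rectifiable_by mu O f.

End rectifiable.
Arguments rectifiable {R} d {M}.

Section partition.
Context {R : realType} {M : pointedMetricType R}.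

Definition equal_measure_partition (mu : probability (borel M) R) N
    (V : 'I_N -> set M) : Prop :=
  [/\ forall i, mu_measurable mu (V i),
      completed mu (~` \bigcup_i V i) = 0%E,
      forall i j, i != j -> completed mu (V i `&` V j) = 0%E &
      forall i, completed mu (V i) = (N%:R^-1)%:E].

Definition diam (V : set M) : R :=
  sup [set mdist y1 y2 | y1 in V & y2 in V].

Definition Diam1 N (V : 'I_N -> set M) : R :=
  N%:R^-1 * \sum_(i < N) diam (V i).

End partition.

(* Main.v *)
Require Import Defs.
From mathcomp Require Import all_boot all_order all_algebra.
From mathcomp Require Import all_classical all_reals all_analysis.
From mathcomp Require Import measurable_realfun.
From mathcomp Require Import ring lra.
Import Order.TTheory GRing.Theory Num.Theory.
Import numFieldNormedType.Exports.
Set Implicit Arguments.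
Unset Strict Implicit.
Unset Printing Implicit Defensive.
Local Open Scope classical_set_scope.
Local Open Scope ring_scope.

(* Let m be the least integer above N^(1/d), so that N <= m^d.  Remove from a
   Borel core A of O (which carries the whole of nu) the null hyperplanes
   x_j = 0.  Cut the rest along the last coordinate into at most m slabs, each but
   the last of nu-measure m^(d-1)/N, cut every slab along the previous coordinate
   into at most m pieces of measure m^(d-2)/N, and so on down to N cells of
   measure 1/N; the cuts exist because nu does not charge hyperplanes.  A slab
   of width w in the last coordinate holds at most m^(d-1) cells, and these
   widths add up to at most 1, so that coordinate contributes at most m^(d-1) to
   the sum of the l1-widths of the cells.  Each of the others contributes by
   induction at most m^(d-2) in each of the m slabs.  The total is thus at
   most d m^(d-1) <= d (2 N^(1/d))^(d-1).
   It is not clear that f maps a Borel cell to a Borel set, so each cell is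
   replaced by a sigma-compact subset of the same nu-measure, whose image is
   sigma-compact. *)

(** * Inner approximation by closed sets for a finite measure *)

Section closed_inner.
Context d (T : measurableType d) (X : topologicalType) {R : realType}.
Variables (g : X -> T) (nu : {finite_measure set T -> \bar R}).
Implicit Types A C : set T.

(* Tuples carry no topology in the library, hence closedness is tested through
   g, later the identification of row vectors with tuples. *)
Definition closed_inner A := forall e : R, 0 < e -> exists C,
  [/\ measurable C, closed (g @^-1` C), C `<=` A & (nu (A `\` C) < e%:E)%E].

(** Continuity from above: the sets [A \ F n] decrease to [A] minus the union, and [nu] is
    finite. *)
Lemma measureD_bigcup_lt A (F : (set T)^nat) (e : R) :
  measurable A -> (forall n, measurable (F n)) -> nondecreasing_seq F ->
  (nu (A `\` \bigcup_n F n) < e%:E)%E -> exists n, (nu (A `\` F n) < e%:E)%E.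
Proof.
move=> mA mF ndF le.
have mAF n : measurable (A `\` F n) by exact: measurableD.
have AFE : A `\` \bigcup_n F n = \bigcap_n (A `\` F n).
  apply/seteqP; split=> [x [Ax nF] n _|x h]; first by split=> // Fx; apply: nF; exists n.
  by split=> [|[n _]]; [case: (h 0%N)|case: (h n)].
have cv : nu \o (fun n => A `\` F n) @ \oo --> nu (A `\` \bigcup_n F n).
  rewrite AFE; apply: nonincreasing_cvg_mu => //.
  - by rewrite -ge0_fin_numE// fin_num_measure.
  - exact: bigcapT_measurable.
  - move=> m n mn; apply/subsetPset => x [Ax nFx]; split => // Fmx.
    by apply: nFx; move/ndF : mn => /subsetPset; exact.
apply: contrapT => /forallNP h; move: le; rewrite -(cvg_lim _ cv)// ltNge => /negP; apply.
apply: lime_ge; first by apply/cvg_ex; eexists; exact: cv.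
by apply: nearW => n; rewrite leNgt; apply/negP/h.
Qed.

Lemma closed_inner_closed C : measurable C -> closed (g @^-1` C) -> closed_inner C.
Proof. by move=> mC cC e e0; exists C; split=> //; rewrite setDv measure0. Qed.

Lemma closed_inner_bigcup_nd (F : (set T)^nat) : (forall n, measurable (F n)) ->
  (forall n, closed (g @^-1` F n)) -> nondecreasing_seq F ->
  closed_inner (\bigcup_n F n).
Proof.
move=> mF cF ndF e e0.
have mUF : measurable (\bigcup_n F n) by exact: bigcupT_measurable.
have [|n Fn] := measureD_bigcup_lt (e := e) mUF mF ndF.
  by rewrite setDv measure0 lte_fin.
by exists (F n); split=> //; exact: bigcup_sup.
Qed.

Lemma closed_inner_seq (A : (set T)^nat) (e : R) : 0 < e ->
  (forall n, measurable (A n)) -> (forall n, closed_inner (A n)) ->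
  exists C : (set T)^nat, [/\ forall n, measurable (C n),
    forall n, closed (g @^-1` C n), forall n, C n `<=` A n &
    (nu (\bigcup_n (A n `\` C n)) < e%:E)%E].
Proof.
move=> e0 mA iA.
(* These errors add up to e/2, not e, which keeps the final bound strict. *)
have h n : 0 < e / 2 / (2 ^ n.+1)%:R :> R by rewrite !divr_gt0// ltr0n expn_gt0.
have /choice[C hC] := fun n => iA n _ (h n).
exists C; split => [n|n|n|]; try by case: (hC n).
have mD n : measurable (A n `\` C n) by apply: measurableD => //; case: (hC n).
apply: (@le_lt_trans _ _ (e / 2)%:E); last by rewrite lte_fin ltr_pdivrMr// ltr_pMr// ltr1n.
have e20 : 0 <= e / 2 by rewrite divr_ge0// ltW.
apply: le_trans (epsilon_trick0 xpredT e20).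
have mUD : measurable (\bigcup_n (A n `\` C n)) by exact: bigcupT_measurable.
apply: le_trans (measure_sigma_subadditive nu mD mUD (@subset_refl _ _)) _.
by apply: lee_nneseries => // n _; case: (hC n) => _ _ _ /ltW.
Qed.

(** A countable union of closed sets need not be closed, so the union of the approximants is
    truncated to a finite one, at arbitrarily small loss. *)
Lemma closed_inner_bigcup (A : (set T)^nat) :
  (forall n, measurable (A n)) -> (forall n, closed_inner (A n)) ->
  closed_inner (\bigcup_n A n).
Proof.
move=> mA iA e e0; have [C [mC cC CA CAe]] := closed_inner_seq e0 mA iA.
pose F n := \bigcup_(i in `I_n.+1) C i.
have mF n : measurable (F n) by apply: bigcup_measurable.
have UF : \bigcup_n F n = \bigcup_n C n.
  apply/seteqP; split=> [x [n _ [i _ ?]]|x [i _ ?]]; first by exists i.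
  by exists i => //; exists i => /=.
have ndF : nondecreasing_seq F.
  move=> m n mn; apply/subsetPset => x [i /= im Ci]; exists i => //=.
  exact: leq_trans im _.
have [||n Fn] := @measureD_bigcup_lt (\bigcup_n A n) F e _ mF ndF.
- exact: bigcupT_measurable.
- rewrite UF; apply: le_lt_trans CAe; apply: le_measure; rewrite ?inE.
  + by apply: measurableD; exact: bigcupT_measurable.
  + by apply: bigcupT_measurable => n; exact: measurableD.
  + move=> x [[n _ Ax] nC]; exists n => //; split=> // Cx; apply: nC.
    by exists n.
- exists (F n); split=> //.
  + by rewrite preimage_bigcup; exact: closed_bigcup.
  + by move=> x [i _ /CA ?]; exists i.
Qed.

Lemma closed_inner_bigcap (A : (set T)^nat) :
  (forall n, measurable (A n)) -> (forall n, closed_inner (A n)) ->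
  closed_inner (\bigcap_n A n).
Proof.
move=> mA iA e e0; have [C [mC cC CA CAe]] := closed_inner_seq e0 mA iA.
exists (\bigcap_n C n); split.
- exact: bigcapT_measurable.
- by rewrite preimage_bigcap; exact: closed_bigI.
- by move=> x Cx n _; apply/CA/Cx.
- apply: le_lt_trans CAe; apply: le_measure; rewrite ?inE.
  + by apply: measurableD; exact: bigcapT_measurable.
  + by apply: bigcupT_measurable => n; exact: measurableD.
  + move=> x [Ax /existsNP[n /not_implyP[_ nC]]]; exists n => //; split=> //.
    exact: Ax.
Qed.

(** Both a set and its complement are approximated, so that the class is visibly stable under
    complements. *)
Definition closed_regular A :=
  [/\ measurable A, closed_inner A & closed_inner (~` A)].

Lemma sigma_algebra_closed_regular : sigma_algebra setT closed_regular.
Proof.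
split=> [|A [mA iA iAC]|F hF].
- by split=> //; apply: closed_inner_closed => //;
    rewrite ?setC0 ?preimage_set0 ?preimage_setT//; exact: closed0.
- by rewrite setTD; split=> //; rewrite ?setCK//; exact: measurableC.
- split; first by apply: bigcupT_measurable => n; case: (hF n).
    by apply: closed_inner_bigcup => n; case: (hF n).
  rewrite setC_bigcup; apply: closed_inner_bigcap => n; case: (hF n) => // mF _ _.
  exact: measurableC.
Qed.

(** Approximants with error below 1/(n+1) for every n together miss only a null set. *)
Lemma closed_inner_ae A : measurable A -> closed_inner A ->
  exists C : (set T)^nat, [/\ forall n, measurable (C n),
    forall n, closed (g @^-1` C n), forall n, C n `<=` A &
    nu (\bigcup_n C n) = nu A].
Proof.
move=> mA iA.
have h n : 0 < n.+1%:R^-1 :> R by rewrite invr_gt0.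
have /choice[C hC] := fun n => iA _ (h n).
exists C; split => [n|n|n|]; try by case: (hC n).
have mU : measurable (\bigcup_n C n).
  by apply: bigcupT_measurable => n; case: (hC n).
have UA : \bigcup_n C n `<=` A.
  by move=> x [n _]; case: (hC n) => _ _ + _; exact.
apply/eqP; rewrite eq_le le_measure ?inE//=.
rewrite -{1}(setDKU UA) measureU//; last by rewrite setDKI.
  rewrite -[leRHS]add0e leeD2r//; apply/lee_addgt0Pr => e e0; rewrite add0e.
  have [n ne] := ltr_add_invr e0; rewrite add0r in ne.
  apply: (@le_trans _ _ (n.+1%:R^-1)%:E); last by rewrite lee_fin ltW.
  case: (hC n) => mC _ _ /ltW; apply: le_trans; apply: le_measure; rewrite ?inE//.
  - exact: measurableD.
  - exact: measurableD.
  - by apply: setDS; apply: bigcup_sup.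
exact: measurableD.
Qed.

End closed_inner.

(** * Closed regularity of finite Borel measures on the space of tuples *)

Section tuple_regularity.
Context {R : realType} {n : nat}.

Definition row_tuple (v : 'rV[R]_n) : Rtuple R n := [tuple v ord0 i | i < n].

Lemma closed_preimage_coord (i : 'I_n) (Y : set R) : closed Y ->
  closed (row_tuple @^-1` ((fun x => tnth x i) @^-1` Y)).
Proof.
move=> cY; rewrite [X in closed X](_ : _ = (fun v : 'rV[R]_n => v ord0 i) @^-1` Y).
  by apply: preimage_closed cY => v _; exact: coord_continuous.
by apply/seteqP; split=> v /=; rewrite tnth_mktuple.
Qed.

Variable nu : {finite_measure set (Rtuple R n) -> \bar R}.

(** Open rays generate the Borel sets of the line. Such a ray is an increasing union of closed rays,
    and its complement is closed. *)
Lemma closed_regular_coord (i : 'I_n) (Y : set (measurableTypeR R)) :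
  measurable Y -> closed_regular row_tuple nu ((fun x => tnth x i) @^-1` Y).
Proof.
have mt Z : measurable Z -> measurable ((fun x : Rtuple R n => tnth x i) @^-1` Z).
  by move=> mZ; rewrite -[X in measurable X]setTI; exact: measurable_tnth.
pose S := [set Y : set R | closed_regular row_tuple nu ((fun x => tnth x i) @^-1` Y)].
have [S0 SC SU] := sigma_algebra_closed_regular row_tuple nu.
have sS : sigma_algebra setT S.
  split=> [|A SA|F SF]; rewrite /S/=.
  - by rewrite preimage_set0.
  - by have := SC _ SA; rewrite !setTD preimage_setC.
  - by rewrite preimage_bigcup; exact: SU.
suff : @measurable _ (measurableTypeR R) `<=` S by apply.
rewrite [X in X `<=` _](RGenOInfty.measurableE R).
apply: smallest_sub => // _ [x ->]; rewrite /S/=.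
have mx : measurable (`]x, +oo[%classic : set (measurableTypeR R)) by exact: measurable_itv.
split; first exact: mt.
- have -> : (fun y : Rtuple R n => tnth y i) @^-1` `]x, +oo[ =
      \bigcup_k (fun y => tnth y i) @^-1` `[x + k.+1%:R^-1, +oo[.
    apply/seteqP; split=> [y/=|y [k _]] /=; rewrite !in_itv/= !andbT.
      move=> /ltr_add_invr[k /ltW xk]; exists k => //.
      by rewrite /= in_itv/= andbT.
    by apply: lt_le_trans; rewrite ltrDl invr_gt0.
  apply: closed_inner_bigcup_nd => [k|k|].
  + by apply: mt; exact: measurable_itv.
  + by apply: closed_preimage_coord; exact: itv_closed_ends_closed.
  + move=> k l kl; apply/subsetPset => y /=; rewrite !in_itv/= !andbT.
    by apply: le_trans; rewrite lerD2l lef_pV2 ?posrE// ler_nat.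
- apply: closed_inner_closed; first by apply: measurableC; exact: mt.
  rewrite preimage_setC; apply: closed_preimage_coord.
  by rewrite setCitvr; exact: itv_closed_ends_closed.
Qed.

(** The regular sets form a sigma-algebra containing the coordinate preimages, which generate the
    product sigma-algebra. *)
Lemma tuple_closed_inner (A : set (Rtuple R n)) : measurable A ->
  closed_inner row_tuple nu A.
Proof.
move=> mA; suff [] : closed_regular row_tuple nu A by [].
apply: (smallest_sub (sigma_algebra_closed_regular _ _) _ mA) => B.
rewrite -bigcup_seq => -[i _ [Y mY <-]]; rewrite setTI.
exact: closed_regular_coord.
Qed.

End tuple_regularity.

(** * Cutting off a prescribed amount of mass at a level of a function *)

Section slicing.
Context d (T : measurableType d) {R : realType}.
Variable nu : {finite_measure set T -> \bar R}.

(** An intermediate value argument for the mass [F] below a level, which is continuous because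
    levels are null. The cut is the supremum of the levels in [a, b] whose mass is at most y. *)
Lemma measure_level_split (v : T -> measurableTypeR R) (A : set T) (a b y : R) :
  measurable_fun setT v -> (forall t, nu (v @^-1` [set t]) = 0%E) ->
  measurable A -> A `<=` v @^-1` `]a, b] -> a <= b ->
  0 <= y -> (y%:E <= nu A)%E ->
  exists2 t, a <= t <= b & nu (A `&` v @^-1` `]-oo, t]) = y%:E.
Proof.
move=> mv v0 mA Aab ab y0 yA.
have mvI (i : interval R) : measurable (A `&` v @^-1` [set` i]).
  apply: measurableI => //; rewrite -[X in measurable X]setTI; exact: mv.
pose F t := nu (A `&` v @^-1` `]-oo, t]).
have F_le s t : s <= t -> (F s <= F t)%E.
  move=> st; apply: le_measure; rewrite ?inE//; apply: setIS => x /=.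
  by rewrite !in_itv/= => /le_trans; apply.
have Fa : F a = 0%E.
  rewrite /F (_ : _ `&` _ = set0) ?measure0//; apply/seteqP; split=> // x [/Aab] /=.
  by rewrite !in_itv/= => /andP[/lt_le_trans h _] /h; rewrite ltxx.
have Fb : F b = nu A.
  congr (nu _); apply/seteqP; split=> [x []//|x Ax]; split=> //.
  by have := Aab _ Ax; rewrite /= !in_itv/= => /andP[].
pose S := [set s | a <= s <= b /\ (F s <= y%:E)%E].
have Sa : S a by rewrite /S/= lexx ab Fa lee_fin.
have ubS : ubound S b by move=> s [/andP[]].
have hS : has_sup S by split; [exists a|exists b].
pose t := sup S.
have tab : a <= t <= b.
  apply/andP; split; first by apply: ub_le_sup => //; exists b.
  by apply: ge_sup => //; exists a.
exists t => //; apply/eqP; rewrite eq_le; apply/andP; split.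
  (* Upper bound, by continuity from the left: the level set at t is null, and each level below t is
     exceeded by some element of [S]. *)
  have mt1 : measurable (v @^-1` [set t]).
    by rewrite -[X in measurable X]setTI; apply: mv.
  have -> : A `&` v @^-1` `]-oo, t] =
      (A `&` v @^-1` `]-oo, t[) `|` (A `&` v @^-1` [set t]).
    rewrite -setIUr -preimage_setU; congr (A `&` v @^-1` _).
    by rewrite setUitv1.
  apply: le_trans (measureU2 _ _ _) _ => //; first exact: measurableI.
  rewrite [X in (_ + X)%E](_ : _ = 0%E) ?adde0; last first.
    apply/eqP; rewrite eq_le measure_ge0 andbT -(v0 t).
    by apply: le_measure; rewrite ?inE//; exact: measurableI.
  have -> : A `&` v @^-1` `]-oo, t[ = \bigcup_k (A `&` v @^-1` `]-oo, t - k.+1%:R^-1]).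
    rewrite -setI_bigcupr; congr (_ `&` _); apply/seteqP; split=> x /=.
      rewrite in_itv/= => /ltr_add_invr[k xk]; exists k => //=.
      by rewrite in_itv/= lerBrDr ltW.
    move=> [k _] /=; rewrite !in_itv/= => /le_lt_trans; apply.
    by rewrite ltrBlDr ltrDl invr_gt0.
  have nd : nondecreasing_seq (fun k => A `&` v @^-1` `]-oo, t - k.+1%:R^-1]).
    move=> k l kl; apply/subsetPset; apply: setIS => x /=.
    rewrite !in_itv/= => /le_trans; apply.
    by rewrite lerD2l lerN2 lef_pV2 ?posrE// ler_nat.
  have cv := @nondecreasing_cvg_mu _ _ _ nu _ (fun k => mvI _)
    (bigcupT_measurable _ (fun k => mvI _)) nd.
  rewrite -[leLHS](cvg_lim _ cv)//.
  apply: lime_le; first by apply/cvg_ex; eexists; exact: cv.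
  apply: nearW => k /=.
  have /(sup_adherent)/(_ hS)[s [sab Fs] ts] : 0 < k.+1%:R^-1 :> R by rewrite invr_gt0.
  by apply: le_trans Fs; apply/F_le/ltW.
(* Lower bound, by continuity from the right. *)
have -> : A `&` v @^-1` `]-oo, t] = \bigcap_k (A `&` v @^-1` `]-oo, t + k.+1%:R^-1]).
  apply/seteqP; split=> [x [Ax vt] k _|x h].
    split=> //; move: vt; rewrite /= !in_itv/= => /le_trans; apply.
    by rewrite lerDl invr_ge0.
  split; first by case: (h 0%N).
  rewrite /= in_itv/= leNgt; apply/negP => /ltr_add_invr[k].
  by have [_] := h k Logic.I; rewrite /= in_itv/= leNgt => /negP.
have ni : nonincreasing_seq (fun k => A `&` v @^-1` `]-oo, t + k.+1%:R^-1]).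
  move=> k l kl; apply/subsetPset; apply: setIS => x /=.
  rewrite !in_itv/= => /le_trans; apply.
  by rewrite lerD2l lef_pV2 ?posrE// ler_nat.
have fin : (nu (A `&` v @^-1` `]-oo, (t + 1%:R^-1)%R]) < +oo)%E.
  by rewrite -ge0_fin_numE// fin_num_measure.
have cv := @nonincreasing_cvg_mu _ _ _ nu _ fin (fun k => mvI _)
  (bigcapT_measurable (fun k => mvI _)) ni.
rewrite -[leRHS](cvg_lim _ cv)//.
apply: lime_ge; first by apply/cvg_ex; eexists; exact: cv.
apply: nearW => k /=.
(* A level beyond b already captures all of [A]; a level up to b with mass at most y would lie in
   [S] above its supremum. *)
have [tb|bt] := leP (t + k.+1%:R^-1) b; last first.
  by apply: le_trans yA _; rewrite -Fb; apply/F_le/ltW.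
rewrite leNgt; apply/negP => /ltW Fy.
have : t + k.+1%:R^-1 <= t.
  apply: ub_le_sup; first by exists b.
  split=> //; rewrite tb andbT (le_trans (andP tab).1)// lerDl.
  by rewrite invr_ge0.
by rewrite leNgt ltrDl invr_gt0 ltr0n.
Qed.

End slicing.

(** * Recursive subdivision into cells of equal measure with controlled total width *)

Section cells.
Context d (T : measurableType d) {R : realType}.
Variables (nu : {finite_measure set T -> \bar R}) (u : nat -> T -> measurableTypeR R).
Hypothesis measurable_u : forall j, measurable_fun setT (u j).
Hypothesis u0 : forall j t, nu (u j @^-1` [set t]) = 0%E.
Variables (c : R) (m : nat).
Hypothesis c0 : 0 <= c.

(** The numbers [W i] stand in for the l1-diameters in the first k coordinates. Only their sum is
    controlled, as an average diameter is sought. *)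
Definition cells k n (A : set T) (L : R) := exists (V : nat -> set T) (W : nat -> R),
  [/\ forall i, (i < n)%N -> [/\ measurable (V i), V i `<=` A & nu (V i) = c%:E],
      forall i j, (i < j < n)%N -> V i `&` V j = set0,
      forall i, (i < n)%N -> forall x y, V i x -> V i y ->
        \sum_(j < k) `|(u j x : R) - u j y| <= W i &
      \sum_(i < n) W i <= L].

Lemma cells0 k A : cells k 0 A 0.
Proof. by exists (fun=> set0), (fun=> 0); split=> //; [move=> i j; rewrite andbF|rewrite big_ord0]. Qed.

Lemma cells1 A : measurable A -> nu A = c%:E -> cells 0 1 A 0.
Proof.
move=> mA nuA; exists (fun=> A), (fun=> 0); split=> //.
- by move=> i _; split.
- by move=> i j /andP[ij]; rewrite ltnS leqn0 => /eqP j0; rewrite j0 in ij.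
- by move=> i _ x y _ _; rewrite big_ord0.
- by rewrite big1.
Qed.

Lemma cells_le k n A B L L' : A `<=` B -> L <= L' -> cells k n A L -> cells k n B L'.
Proof.
move=> AB LL' [V [W [hV dV hW WL]]]; exists V, W; split=> //.
  by move=> i /hV[mV VA nuV]; split=> //; exact: subset_trans AB.
exact: le_trans LL'.
Qed.

Lemma cells_cat k n1 n2 A1 A2 L1 L2 : A1 `&` A2 = set0 ->
  cells k n1 A1 L1 -> cells k n2 A2 L2 ->
  cells k (n1 + n2) (A1 `|` A2) (L1 + L2).
Proof.
move=> A12 [V1 [W1 [hV1 dV1 hW1 W1L]]] [V2 [W2 [hV2 dV2 hW2 W2L]]].
exists (fun i => if (i < n1)%N then V1 i else V2 (i - n1)%N).
exists (fun i => if (i < n1)%N then W1 i else W2 (i - n1)%N).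
have lt2 i : (i < n1 + n2)%N -> (n1 <= i)%N -> (i - n1 < n2)%N.
  by move=> ? ?; rewrite ltn_subLR.
split.
- move=> i ilt; case: ltnP => [/hV1|/(lt2 _ ilt)/hV2] [mV VA ?]; split=> //.
    by apply: subset_trans VA _; exact: subsetUl.
  by apply: subset_trans VA _; exact: subsetUr.
- move=> i j /andP[ij jn]; case: (ltnP i n1) => i1; case: (ltnP j n1) => j1.
  + by apply: dV1; rewrite ij.
  + apply/seteqP; split=> // x [V1x V2x]; rewrite -A12; split.
      by have [_ + _] := hV1 _ i1; exact.
    by have [_ + _] := hV2 _ (lt2 _ jn j1); exact.
  + by move: (leq_ltn_trans i1 (ltn_trans ij j1)); rewrite ltnn.
  + by apply: dV2; rewrite ltn_sub2r ?lt2// (leq_ltn_trans i1).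
- by move=> i ilt; case: ltnP => [/hW1|/(lt2 _ ilt)/hW2]; exact.
- rewrite big_split_ord/=; apply: lerD; [move: W1L|move: W2L]; apply: le_trans.
    by apply: ler_sum => i _; rewrite ltn_ord.
  by apply: ler_sum => i _; rewrite ltnNge leq_addr/= addKn.
Qed.

(** All n cells lie in the same slab, so each pays at most its width b - a for the additional
    coordinate. *)
Lemma cells_next k n A L a b : A `<=` u k @^-1` `]a, b] ->
  cells k n A L -> cells k.+1 n A (n%:R * (b - a) + L).
Proof.
move=> Aab [V [W [hV dV hW WL]]]; exists V, (fun i => (b - a) + W i); split=> //.
- move=> i ilt x y Vx Vy; rewrite big_ord_recr/= addrC; apply: lerD; last exact: hW.
  have [_ VA _] := hV _ ilt.
  have := Aab _ (VA _ Vx); have := Aab _ (VA _ Vy); rewrite /= !in_itv/=.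
  move: (u k x : R) (u k y : R) => p q /andP[ay yb] /andP[ax xb].
  by rewrite ler_norml; apply/andP; split; lra.
- by rewrite big_split/= sumr_const card_ord mulr_natl lerD2l.
Qed.

(* The induction on r cuts off one slab of min(n, m ^ k) cells at a time. *)
Lemma cells_slabs k :
  (forall n A, (n <= m ^ k)%N -> measurable A -> nu A = (n%:R * c)%:E ->
     (forall j, (j < k)%N -> A `<=` u j @^-1` `]0, 1]) ->
     cells k n A (k%:R * m%:R ^+ k.-1)) ->
  forall r n A a b, (n <= r * m ^ k)%N -> measurable A ->
    nu A = (n%:R * c)%:E ->
    (forall j, (j < k)%N -> A `<=` u j @^-1` `]0, 1]) ->
    A `<=` u k @^-1` `]a, b] -> a <= b ->
    cells k.+1 n A ((m ^ k)%:R * (b - a) + r%:R * (k%:R * m%:R ^+ k.-1)).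
Proof.
move=> IH; elim=> [|r IHr] n A a b; rewrite ?mulSn => nr mA nuA Aj Aab ab.
  move: nr; rewrite mul0n leqn0 => /eqP ->; rewrite mul0r addr0.
  by apply: cells_le (cells0 k.+1 A) => //; rewrite mulr_ge0// subr_ge0.
pose n1 := minn n (m ^ k).
have n1n : (n1 <= n)%N by exact: geq_minl.
have n1k : (n1 <= m ^ k)%N by exact: geq_minr.
have y0 : 0 <= n1%:R * c by rewrite mulr_ge0.
have yA : ((n1%:R * c)%:E <= nu A)%E by rewrite nuA lee_fin ler_wpM2r// ler_nat.
have [t /andP[ta tb] nut] := measure_level_split (measurable_u k) (u0 k) mA Aab ab y0 yA.
set A1 := A `&` _ in nut.
have mA1 : measurable A1.
  apply: measurableI => //; rewrite -[X in measurable X]setTI; exact: measurable_u.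
have A1A : A1 `<=` A by move=> x [].
have A1t : A1 `<=` u k @^-1` `]a, t].
  move=> x [/Aab]; rewrite /= !in_itv/= => /andP[-> _].
  by [].
have A2t : A `\` A1 `<=` u k @^-1` `]t, b].
  move=> x [Ax nA1]; have := Aab _ Ax; rewrite /= !in_itv/= => /andP[_ ->].
  by rewrite andbT ltNge; apply/negP => xt; apply: nA1; split; rewrite //= in_itv.
have nu2 : nu (A `\` A1) = ((n - n1)%:R * c)%:E.
  rewrite measureD//; last by rewrite -ge0_fin_numE// fin_num_measure.
  by rewrite setIidr// [X in (X - _)%E]nuA [X in (_ - X)%E]nut natrB// mulrBl EFinB.
have C1 := cells_next A1t (IH _ _ n1k mA1 nut
  (fun j jk => subset_trans A1A (Aj j jk))).
have C2 := IHr (n - n1)%N (A `\` A1) t b _ (measurableD mA mA1) nu2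
  (fun j jk => subset_trans (@subDsetl _ _ _) (Aj j jk)) A2t tb.
rewrite -(subnKC n1n).
apply: cells_le (cells_cat _ C1 (C2 _)).
- by move=> x [/A1A|[]].
(* The slab is charged m^k (t - a) and the remainder m^k (b - t), which telescopes to m^k (b -
   a). *)
- have : n1%:R * (t - a) <= (m ^ k)%:R * (t - a).
    by rewrite ler_wpM2r ?subr_ge0// ler_nat.
  rewrite -[r.+1]addn1 natrD; move: (n1%:R * _) => z zle.
  apply: (@le_trans _ _ ((m ^ k)%:R * (t - a) + k%:R * m%:R ^+ k.-1 +
     ((m ^ k)%:R * (b - t) + r%:R * (k%:R * m%:R ^+ k.-1)))).
    by rewrite lerD2r lerD2r.
  by rewrite le_eqVlt; apply/orP; left; apply/eqP; ring.
- by rewrite setDE setICA setICr setI0.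
- rewrite leq_subLR /n1; case: (leqP n (m ^ k)) => h; last by [].
  by rewrite leq_addr.
Qed.

(** Induction on k: m slabs across ]0, 1] cost m^k for the new coordinate and m times the previous
    bound for the others, and m^k + m k m^(k-1) = (k+1) m^k. *)
Lemma cells_exist k n A : (n <= m ^ k)%N -> measurable A ->
  nu A = (n%:R * c)%:E ->
  (forall j, (j < k)%N -> A `<=` u j @^-1` `]0, 1]) ->
  cells k n A (k%:R * m%:R ^+ k.-1).
Proof.
elim: k n A => [|k IH] n A nm mA nuA Aj.
  rewrite mul0r; case: n nm nuA => [_ _|[_ nuA|//]]; first exact: cells0.
  by apply: cells1; rewrite // nuA mul1r.
have := cells_slabs IH (r := m) (a := 0) (b := 1) _ mA nuA _ _ ler01.
rewrite -expnS => /(_ nm); rewrite subr0 mulr1 natrX => h.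
apply: cells_le (h _ _) => //; last 2 first.
- by move=> j jk; apply: Aj; exact: ltnW.
- exact: Aj.
rewrite -natr1 mulrDl mul1r addrC lerD2r /=.
(* For k = 0 the truncated exponent [k.-1] is harmless, since the factor k vanishes. *)
case: k {IH nm Aj h} => [|k]; first by rewrite !mul0r mulr0.
by rewrite mulrCA -exprS.
Qed.

End cells.

(** * Lipschitz estimates and Borel images of closed sets *)

Section lipschitz.
Context {R : realType} {n : nat} {M : pointedMetricType R}.
Variables (O : set (Rtuple R n)) (f : Rtuple R n -> M).
Hypothesis lipf : lipschitz_constants O f !=set0.

Lemma euclidean_dist_le (x y : Rtuple R n) :
  euclidean_dist x y <= \sum_(i < n) `|(tnth x i : R) - tnth y i|.
Proof.
rewrite /euclidean_dist -[leRHS]ger0_norm ?sumr_ge0// -sqrtr_sqr.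
apply: ler_wsqrtr.
pose P (a b : R) := 0 <= b /\ a <= b ^+ 2.
suff [] : P (\sum_(i < n) ((tnth x i : R) - tnth y i) ^+ 2)
            (\sum_(i < n) `|(tnth x i : R) - tnth y i|) by [].
apply: (big_ind2 P) => [|a b a' b' [b0 ab] [b0' ab']|i _]; rewrite /P.
- by rewrite expr0n.
- by rewrite addr_ge0// sqrrD; nra.
- by rewrite real_normK ?num_real.
Qed.

Lemma euclidean_dist_gt0 (x y : Rtuple R n) : x != y -> 0 < euclidean_dist x y.
Proof.
move=> xy; rewrite sqrtr_gt0 lt_def sumr_ge0 ?andbT; last by move=> i _; exact: sqr_ge0.
apply: contra xy; rewrite psumr_eq0; last by move=> i _; exact: sqr_ge0.
move=> /allP h; apply/eqP/eq_from_tnth => i; apply/eqP.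
by have := h i (mem_index_enum _); rewrite sqrf_eq0 subr_eq0.
Qed.

(** For distinct points the ratio of the distances is a lower bound of all Lipschitz constants,
    hence at most their infimum. *)
Lemma LipP x y : O x -> O y -> mdist (f x) (f y) <= Lip O f * euclidean_dist x y.
Proof.
move=> Ox Oy; have [->|xy] := eqVneq x y.
  rewrite mdistxx /euclidean_dist (_ : \sum_(i < n) _ = 0) ?sqrtr0 ?mulr0//.
  by rewrite big1// => i _; rewrite subrr expr0n.
rewrite -ler_pdivrMr ?euclidean_dist_gt0//; apply: lb_le_inf => // c hc.
by rewrite ler_pdivrMr ?euclidean_dist_gt0//; exact: hc.
Qed.

(** Two distinct points of [O] force the sign. Otherwise every real is a Lipschitz constant, and
    [inf] of a set unbounded below is 0 by default. *)
Lemma Lip_ge0 : 0 <= Lip O f.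
Proof.
have [[x [y [Ox Oy xy]]]|h] := pselect (exists x y, [/\ O x, O y & x != y]).
  have := le_trans (mdist_ge0 (f x) (f y)) (LipP Ox Oy).
  by rewrite pmulr_lge0// euclidean_dist_gt0.
rewrite /Lip inf_out// => -[_ [b hb]].
suff /hb : lipschitz_constants O f (b - 1) by rewrite lerBrDr gerDl ler10.
move=> x y Ox Oy; have [->|xy] := eqVneq x y; last by case: h; exists x, y.
rewrite mdistxx /euclidean_dist (_ : \sum_(i < n) _ = 0) ?sqrtr0 ?mulr0//.
by rewrite big1// => i _; rewrite subrr expr0n.
Qed.

Lemma Lip_l1 x y : O x -> O y ->
  mdist (f x) (f y) <= Lip O f * \sum_(i < n) `|(tnth x i : R) - tnth y i|.
Proof.
move=> Ox Oy; apply: le_trans (LipP Ox Oy) _.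
by rewrite ler_wpM2l ?Lip_ge0// euclidean_dist_le.
Qed.

Lemma within_continuous_row_tuple (K : set 'rV[R]_n) :
  K `<=` row_tuple @^-1` O -> {within K, continuous (f \o row_tuple)}.
Proof.
move=> KO; apply/subspace_continuousP => v Kv.
apply/metricType_numDomainType.cvgrPdist_lt => e e0; rewrite near_withinE.
(* The factor n compares the l1 distance with the sup distance of row vectors; the added 1 gives
   positivity and a strict final bound. *)
pose L := Lip O f * n%:R + 1.
have L0 : 0 < L by rewrite ltr_wpDl// mulr_ge0 ?Lip_ge0.
have eL0 : 0 < e / L by rewrite divr_gt0.
apply/nbhs_ballP; exists (e / L) => //= w vw Kw.
apply: le_lt_trans (Lip_l1 (KO _ Kv) (KO _ Kw)) _.
have : \sum_(i < n) `|(tnth (row_tuple v) i : R) - tnth (row_tuple w) i| <= n%:R * (e / L).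
  rewrite mulr_natl -[X in _ *+ X]card_ord -sumr_const; apply: ler_sum => i _.
  by rewrite !tnth_mktuple; case: vw => _ /(_ ord0 i) /ltW.
move=> /(ler_wpM2l Lip_ge0)/le_lt_trans; apply.
by rewrite !mulrA ltr_pdivrMr// [ltRHS]mulrC ltr_pM2r// ltrDl.
Qed.

(** A closed part of the cube is compact, so its image under the continuous restriction of [f] is
    compact, hence closed in the Hausdorff space [M]. *)
Lemma measurable_image_closed (C : set (Rtuple R n)) :
  closed (row_tuple @^-1` C) -> C `<=` O -> C `<=` unit_cube ->
  measurable (f @` C : set (borel M)).
Proof.
move=> cC CO C1.
have kK : compact (row_tuple @^-1` C).
  apply: (subclosed_compact cC).
    by apply: (@rV_compact R n (fun=> `[0, 1]%classic)) => _; exact: segment_compact.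
  by move=> v /C1 + i => /(_ i); rewrite tnth_mktuple /= in_itv.
have -> : f @` C = (f \o row_tuple) @` (row_tuple @^-1` C).
  apply/seteqP; split=> [_ [x Cx <-]|_ [v Cv <-]]; last by exists (row_tuple v).
  have rx : row_tuple (\row_i tnth x i) = x.
    by apply/eq_from_tnth => i; rewrite tnth_mktuple mxE.
  by exists (\row_i tnth x i); rewrite /= rx.
have : closed ((f \o row_tuple) @` (row_tuple @^-1` C)).
  apply: compact_closed; first exact: metric_hausdorff.
  apply: continuous_compact kK; apply: within_continuous_row_tuple.
  by move=> v /CO.
rewrite -openC => oC; rewrite -[X in measurable X]setCK; apply: measurableC.
exact: sub_sigma_algebra.
Qed.

End lipschitz.

(** * Completed measures, null hyperplanes and the number of slabs *)

Lemma completedE d (T : measurableType d) (R : realType)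
  (mu : {measure set T -> \bar R}) A : measurable A -> completed mu A = mu A.
Proof. exact: measurable_mu_extE. Qed.

Lemma mu_measurableW d (T : measurableType d) (R : realType)
  (mu : {measure set T -> \bar R}) A : measurable A -> mu_measurable mu A.
Proof. by move=> mA; exists A => //; exists set0; [exact: negligible_set0|rewrite setU0]. Qed.

(** The hyperplane is a box with a singleton side, whose zero factor annihilates the product even
    against infinite sides. *)
Lemma lebesgue_tuple_hyperplane {R : realType} n (i : 'I_n) (t : R) :
  lebesgue_tuple n [set x : Rtuple R n | tnth x i = t] = 0%E.
Proof.
pose A j := if j == i then [set t] else setT : set (measurableTypeR R).
have mA j : measurable (A j) by rewrite /A; case: ifP.
have -> : [set x : Rtuple R n | tnth x i = t] = [set x | forall j, A j (tnth x j)].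
  apply/seteqP; split=> x /= h; last by have := h i; rewrite /A eqxx.
  by move=> j; rewrite /A; case: eqP => // ->.
rewrite lebesgue_tuple_box// (bigD1 i)//= /A eqxx.
by rewrite [X in (X * _)%E](_ : _ = 0%E) ?mul0e//; exact: lebesgue_measure_set1.
Qed.

Lemma exists_side (R : realType) (d N : nat) : (0 < d)%N -> (0 < N)%N ->
  exists2 m, (N <= m ^ d)%N &
    N%:R^-1 * (d%:R * m%:R ^+ d.-1) <= d%:R * 2 ^+ d.-1 * N%:R `^ (- d%:R^-1) :> R.
Proof.
move=> d0 N0; pose y : R := N%:R `^ d%:R^-1.
have y1 : 1 <= y.
  by rewrite /y -[leLHS](powRr0 N%:R) ler_powR ?ler1n ?invr_ge0.
have yd : y ^+ d = N%:R.
  rewrite /y -powR_mulrn ?powR_ge0// -powRrM mulVf ?pnatr_eq0 -?lt0n// powRr1//.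
have y0 : 0 < y by exact: lt_le_trans y1.
have /andP[my ym] := trunc_itv (ltW y0).
exists (Num.trunc y).+1.
  rewrite -(ler_nat R) natrX -yd lerXn2r// ?nnegrE ?ltW//.
rewrite powRN -/y.
have Ny : N%:R^-1 = y^-1 * (y ^+ d.-1)^-1 by rewrite -invfM -exprS prednK// yd.
(* Since y >= 1, rounding up at most doubles it; this is the origin of the power of 2. *)
set m := (Num.trunc y).+1 in ym *; have my2 : m%:R <= 2 * y by rewrite /m -natr1; lra.
rewrite Ny (_ : _ * _ = d%:R * (m%:R / y) ^+ d.-1 * y^-1); last first.
  by rewrite expr_div_n; ring.
have yge0 := ltW y0.
apply: ler_wpM2r; first by rewrite invr_ge0.
apply: ler_wpM2l => //; apply: lerXn2r; rewrite ?nnegrE ?divr_ge0//.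
by rewrite ler_pdivrMr.
Qed.

(** * Transport of measure between the cube and the metric space *)

Section rectifiable_partition.
Context {R : realType} {n : nat} {M : pointedMetricType R}.
Variables (mu : probability (borel M) R) (O : set (Rtuple R n)) (f : Rtuple R n -> M).
Variable nu : {finite_measure set (Rtuple R n) -> \bar R}.
Hypotheses (injf : {in O &, injective f})
  (muf : forall E, mu_measurable mu E ->
    completed mu E = completed nu (O `&` f @^-1` (E `&` f @` O))).

Lemma measure_image B : measurable B -> B `<=` O ->
  measurable (f @` B : set (borel M)) -> mu (f @` B) = nu B.
Proof.
move=> mB BO mfB; rewrite -(completedE mu mfB) -(completedE nu mB).
rewrite muf; last exact: mu_measurableW.
congr (completed nu _); apply/seteqP; split=> [x [Ox [[y By yx] _]]|x Bx].
  by rewrite -(injf _ _ yx) ?inE//; exact: BO.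
have Ox := BO _ Bx.
by split=> //; split; exists x.
Qed.

(** [O] differs from a Borel subset by part of a Lebesgue-null set, which is also [nu]-null; the
    transport formula on the whole space gives [O] mass 1. *)
Lemma rectifiable_core : nu `<< lebesgue_tuple n ->
  mu_measurable (lebesgue_tuple n) O ->
  exists A, [/\ measurable A, A `<=` O & nu A = 1%E].
Proof.
move=> nul [A mA [Z [B [mB B0 ZB]] AZO]]; exists A.
have AO : A `<=` O by rewrite -AZO; exact: subsetUl.
have nuB : nu B = 0%E.
  apply: nul (mB) (@subset_refl _ _) => C mC CB; apply/eqP.
  by rewrite eq_le measure_ge0 andbT -B0 le_measure// inE.
have nuO : completed nu O = 1%E.
  have /muf := mu_measurableW mu (@measurableT _ (borel M)).
  rewrite completedE// [X in X = _](@probability_setT _ _ _ mu) => ->; congr (completed nu _).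
  by apply/seteqP; split=> [x Ox|x []//]; split=> //; split=> //; exists x.
split=> //; apply/eqP; rewrite eq_le -{1}nuO -completedE// le_mu_ext//=.
rewrite -nuO; apply: (@le_trans _ _ (completed nu (A `|` B))).
  by apply: le_mu_ext; rewrite -AZO; exact: setUS.
rewrite completedE; last exact: measurableU.
apply: le_trans (measureU2 _ mA mB) _.
by rewrite [X in (_ + X)%E]nuB adde0 completedE.
Qed.

End rectifiable_partition.

(** * Assembly of the partition and the bound on its average diameter *)

Lemma diam_le {R : realType} {M : pointedMetricType R} (V : set M) (r : R) :
  0 <= r -> (forall x y, V x -> V y -> mdist x y <= r) -> diam V <= r.
Proof.
move=> r0 h; rewrite /diam; set S := [set _ | _ in _ & _ in _].
(* An empty set has diameter 0 by default, whence the assumption on r. *)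
have [->|/set0P S0] := eqVneq S set0; first by rewrite sup0.
by apply: ge_sup => // _ [x Vx [y Vy <-]]; exact: h.
Qed.

(** N disjoint sets of measure 1/N exhaust the mass of a probability, so their union has null
    complement. *)
Lemma equal_measure_partitionP {R : realType} {M : pointedMetricType R}
    (mu : probability (borel M) R) N (V : 'I_N -> set M) : (0 < N)%N ->
  (forall i, measurable (V i : set (borel M))) ->
  (forall i j, i != j -> V i `&` V j = set0) ->
  (forall i, mu (V i) = (N%:R^-1)%:E) -> equal_measure_partition mu V.
Proof.
move=> N0 mV dV muV; split=> [i||i j ij|i].
- exact: mu_measurableW.
- have -> : \bigcup_i V i = \big[setU/set0]_(i < N) V i.
    by rewrite -bigcup_seq; apply/seteqP; split=> x [i _ Vx]; exists i; rewrite //= mem_index_enum.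
  have mU : measurable (\big[setU/set0]_(i < N) V i : set (borel M)).
    exact: bigsetU_measurable.
  rewrite completedE; last exact: measurableC.
  rewrite [LHS](@probability_setC _ _ _ mu)//.
  rewrite [X in (_ - X)%E](measure_bigsetU_ord mu xpredT)//; last first.
    by apply/trivIsetP => i j _ _; exact: dV.
  rewrite (eq_bigr (fun=> (N%:R^-1)%:E)); last by move=> i _; exact: muV.
  rewrite sumEFin sumr_const card_ord -[_ *+ N]mulr_natl mulfV ?subee//.
  by rewrite pnatr_eq0 -lt0n.
- by rewrite dV// completedE// measure0.
- by rewrite completedE//; exact: muV.
Qed.

Theorem theorem4p1 (R : realType) (d : nat) (M : pointedMetricType R)
    (mu : probability (borel M) R)
    (O : set (Rtuple R d)) (f : Rtuple R d -> M) :
  (0 < d)%N ->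
  compact [set: M] ->
  rectifiable_by mu O f ->
  forall N : nat, (0 < N)%N ->
  exists V : 'I_N -> set M,
    equal_measure_partition mu V /\
    Diam1 V <= d%:R * 2 ^+ d.-1 * Lip O f * N%:R `^ (- d%:R^-1).
Proof.
(* From here on the dimension is [d.+1]. *)
case: d O f => // d O f _ _ [nu [_ nul [mO O1] [injf lipf] [_ muf]]] N N0.
have [A [mA AO nuA]] := rectifiable_core muf nul mO.
have [m Nm mle] := exists_side R (ltn0Sn d) N0.
(* Coordinates are numbered by all naturals; [inord] sends an index out of range to a genuine
   coordinate, so every [u j] has null levels. *)
pose u j (x : Rtuple R d.+1) : measurableTypeR R := tnth x (inord j).
have measurable_u j : measurable_fun setT (u j) by exact: measurable_tnth.
have u0 j t : nu (u j @^-1` [set t]) = 0%E.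
  have mt : measurable (u j @^-1` [set t]) by rewrite -[X in measurable X]setTI; exact: measurable_u.
  apply: nul (mt) (@subset_refl _ _) => C mC Ct; apply/eqP.
  by rewrite eq_le measure_ge0 andbT -(@lebesgue_tuple_hyperplane R d.+1 (inord j) t) le_measure// inE.
(* Off [Z] the coordinates of points of [A] lie in ]0, 1], as the half-open slabs require. *)
pose Z := \bigcup_j u j @^-1` [set 0].
have mZj j : measurable (u j @^-1` [set 0]).
  by rewrite -[X in measurable X]setTI; exact: measurable_u.
have mZ : measurable Z by exact: bigcupT_measurable.
have nuZ : nu Z = 0%E.
  apply/eqP; rewrite eq_le measure_ge0 andbT.
  apply: le_trans (measure_sigma_subadditive nu mZj mZ (@subset_refl _ _)) _.
  by rewrite eseries0// => j _ _; exact: u0.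
have mAZ : measurable (A `\` Z) by exact: measurableD.
have nuAZ : nu (A `\` Z) = (N%:R * N%:R^-1)%:E.
  rewrite mulfV ?pnatr_eq0 -?lt0n// -nuA; apply/eqP.
  rewrite eq_le le_measure ?inE//=.
  apply: (@le_trans _ _ (nu ((A `\` Z) `|` Z))).
    apply: le_measure; rewrite ?inE//; first exact: measurableU.
    by move=> x Ax; have [Zx|nZx] := pselect (Z x); [right|left].
  apply: le_trans (measureU2 _ mAZ mZ) _.
  by rewrite [X in (_ + X)%E]nuZ adde0.
have AZ01 j : (j < d.+1)%N -> A `\` Z `<=` u j @^-1` `]0, 1].
  move=> _ x [Ax nZ]; have /andP[x0 x1] := O1 _ (AO _ Ax) (inord j).
  rewrite /= in_itv/= x1 andbT lt_neqAle x0 andbT.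
  by apply/eqP => xj0; apply: nZ; exists j.
have c0 : 0 <= N%:R^-1 :> R by rewrite invr_ge0.
have [V [W [hV dV hW WL]]] := cells_exist measurable_u u0 c0 Nm mAZ nuAZ AZ01.
have /choice[C hC] (i : 'I_N) := let: And3 mVi _ _ := hV i (ltn_ord i) in
  closed_inner_ae mVi (tuple_closed_inner nu mVi).
pose B i := \bigcup_k C i k.
have BV i : B i `<=` V i by move=> x [k _]; case: (hC i) => _ _ + _; exact.
have BO i : B i `<=` O.
  by move=> x /BV; have [_ VA _] := hV _ (ltn_ord i); move/VA => [/AO].
have mB i : measurable (B i) by apply: bigcupT_measurable; case: (hC i).
have mfB i : measurable (f @` B i : set (borel M)).
  rewrite image_bigcup; apply: bigcupT_measurable => k.
  have CB : C i k `<=` B i by exact: bigcup_sup.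
  apply: (measurable_image_closed lipf); first by case: (hC i).
    exact: subset_trans (BO i).
  by apply: subset_trans O1; exact: subset_trans (BO i).
exists (fun i => f @` B i); split.
  apply: equal_measure_partitionP => // [i j ij|i].
    have VV : V i `&` V j = set0.
      move: ij; rewrite neq_ltn => /orP[ij|ij]; first by apply: dV; rewrite ij /=.
      by rewrite setIC; apply: dV; rewrite ij /=.
    apply/seteqP; split=> // _ [[x Bx <-] [y By yx]].
    have xy : y = x by apply: injf; rewrite ?inE//; [exact: BO By|exact: BO Bx].
    rewrite xy in By; have : (V i `&` V j) x by split; [exact: BV Bx|exact: BV By].
    by rewrite VV.
  rewrite (measure_image injf muf)//; case: (hC i) => _ _ _ ->.
  by case: (hV i (ltn_ord i)).
have L0 := Lip_ge0 lipf.
rewrite /Diam1.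
have dW (i : 'I_N) : diam (f @` B i) <= Lip O f * W i.
  (* A cell of positive measure has a point, and [W i] bounds the l1 distance from that point to
     itself. *)
  have W0 : 0 <= W i.
    have [x Vx] : V i !=set0.
      apply/set0P/eqP => V0; case: (hV i (ltn_ord i)) => _ _.
      by rewrite V0 measure0 => -[] /esym/eqP; rewrite invr_eq0 pnatr_eq0 gtn_eqF.
    by apply: le_trans (hW i (ltn_ord i) x x Vx Vx); exact: sumr_ge0.
  apply: diam_le => [|_ _ [x Bx <-] [y By <-]]; first exact: mulr_ge0.
  apply: le_trans (Lip_l1 lipf (BO i _ Bx) (BO i _ By)) _; apply: ler_wpM2l => //.
  apply: le_trans (hW i (ltn_ord i) x y (BV i _ Bx) (BV i _ By)).
  by apply: ler_sum => j _; rewrite /u inord_val.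
apply: (@le_trans _ _ (N%:R^-1 * (Lip O f * (d.+1%:R * m%:R ^+ d)))).
  rewrite ler_wpM2l//; apply: le_trans (ler_sum _ (fun i _ => dW i)) _.
  by rewrite -mulr_sumr ler_wpM2l.
rewrite mulrCA [leRHS]mulrAC [leRHS]mulrC.
exact: ler_wpM2l.
Qed.
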